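(* If $\kappa$ is an uncountable cardinal and $\mathbb{P}$ is a complete Boolean algebra that does not add bounded subsets of $\kappa$, then $$(\forall q\in\mathbb{P}\ \ \mathsf{ub}\text{-}\mathsf{FA}_{\mathbb{P}_q,\kappa})\ \Longrightarrow\ \mathsf{BFA}^\kappa_{\mathbb{P},\kappa}.$$
   Context: Forcing with a complete Boolean algebra means forcing with its nonzero elements (so $q$ ranges over nonzero elements), and $\mathbb{P}_q=\{p\in\mathbb{P}\mid p\leq q\}$. ''$\mathbb{P}$ does not add bounded subsets of $\kappa$'' means that no generic extension by $\mathbb{P}$ contains a bounded subset of $\kappa$ that is not in the ground model $V$. For a forcing $\mathbb{Q}$, $\mathsf{ub}\text{-}\mathsf{FA}_{\mathbb{Q},\kappa}$ states: for any sequence $\langle D_\alpha\mid\alpha<\kappa\rangle$ of dense subsets of $\mathbb{Q}$ there is a filter $g\in V$ on $\mathbb{Q}$ with $g\cap D_\alpha\neq\emptyset$ for unboundedly many $\alpha<\kappa$. $\mathsf{BFA}^\kappa_{\mathbb{P},\kappa}$ states: for any sequence $\langle D_\alpha\mid\alpha<\kappa\rangle$ of predense subsets of $\mathbb{P}$, each of size at most $\kappa$, there is a filter $g\in V$ on $\mathbb{P}$ with $g\cap D_\alpha\neq\emptyset$ for all $\alpha<\kappa$. *)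

(* Defs.v *)
From mathcomp Require Import all_boot all_order.
From mathcomp Require Import boolp classical_sets functions cardinality.

Set Implicit Arguments.
Unset Strict Implicit.
Unset Printing Implicit Defensive.

Import Order.TTheory.
Local Open Scope classical_set_scope.
Local Open Scope card_scope.
Local Open Scope order_scope.

(* A cardinal is given as an initial ordinal: a well-ordered type K, whose
   elements are the ordinals below the cardinal, none of whose proper initial
   segments is equinumerous with K. *)
Record uncountable_cardinal d (K : orderType d) : Prop := {
  cardinal_wf : well_founded (fun x y : K => x < y);
  cardinal_initial : forall a : K, ~ ([set: K] #<= [set x : K | x < a])%classic;
  cardinal_uncountable : ~ countable [set: K] }.

(* A forcing notion is a subset Q of a partial order, with the induced order. *)
Section Forcing.
Context {d : Order.disp_t} {T : porderType d}.
Implicit Types Q D g : set T.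

Definition compatible_in Q (p q : T) : Prop :=
  exists r, [/\ Q r, r <= p & r <= q].

Definition dense_in Q D : Prop :=
  (D `<=` Q)%classic /\ forall p, Q p -> exists2 r, D r & r <= p.

Definition predense_in Q D : Prop :=
  (D `<=` Q)%classic /\
  forall p, Q p -> exists2 r, D r & compatible_in Q p r.

Definition filter_on Q g : Prop :=
  [/\ (g `<=` Q)%classic,
      (g !=set0)%classic,
      forall p q, g p -> Q q -> p <= q -> g q
    & forall p q, g p -> g q -> exists r, [/\ g r, r <= p & r <= q]].

Definition meets g D : Prop := (g `&` D !=set0)%classic.

Definition ub_FA Q d' (K : orderType d') : Prop :=
  forall D : K -> set T, (forall a, dense_in Q (D a)) ->
  exists2 g, filter_on Q g & forall b : K, exists2 a, b <= a & meets g (D a).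

Definition BFA Q d' (K : orderType d') : Prop :=
  forall D : K -> set T,
    (forall a, predense_in Q (D a)) ->
    (forall a, D a #<= [set: K]) ->
  exists2 g, filter_on Q g & forall a : K, meets g (D a).

End Forcing.

(* The ground model V: a set is given by a family of sets, its elements. *)
Inductive vset : Type := VSet (A : Type) of A -> vset.

(* The von Neumann ordinal { ordinal y | y < x } of a point x of a
   well-order. *)
Definition ordinal_vset d (K : orderType d)
    (wfK : well_founded (fun x y : K => x < y)) : K -> vset :=
  Fix wfK (fun=> vset)
    (fun x rec => @VSet {y : K | y < x} (fun y => rec (sval y) (svalP y))).

(* The Boolean-valued model V^B: BName f a has the elements f i, with Boolean
   value a i. *)
Inductive bname (B : Type) : Type :=
  BName (A : Type) of (A -> bname B) & (A -> B).

Section BooleanAlgebra.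
Context {d : Order.disp_t} {B : ctbDistrLatticeType d}.

(* The one-element algebra is excluded: it has no nonzero conditions. *)
Definition complete_algebra : Prop :=
  (\bot : B) != \top /\ forall A : set B, (supremums A !=set0)%classic.

Definition conditions : set B := [set p : B | p != \bot]%classic.

Definition conditions_below (q : B) : set B :=
  [set p : B | p != \bot /\ p <= q]%classic.

(* These are not written with range, whose universe is too small for the
   supremum over all of vset below. *)
Definition bsup (I : Type) (F : I -> B) : B := supremum \bot [set b | exists i, b = F i]%classic.
Definition binf (I : Type) (F : I -> B) : B := infimum \top [set b | exists i, b = F i]%classic.
Definition bimp (a b : B) : B := ~` a `|` b.

(* The Boolean value of x = y, i.e. of x \subset y and y \subset x, with
   the Boolean values of the memberships unfolded. *)
Fixpoint beq (x y : bname B) {struct x} : B :=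
  let: BName X f a := x in let: BName Y g b := y in
  binf (fun i => bimp (a i) (bsup (fun j => b j `&` beq (f i) (g j)))) `&`
  binf (fun j => bimp (b j) (bsup (fun i => a i `&` beq (f i) (g j)))).

Definition bmem (x y : bname B) : B :=
  let: BName Y g b := y in bsup (fun j => b j `&` beq x (g j)).

Definition bsub (x y : bname B) : B :=
  let: BName X f a := x in binf (fun i => bimp (a i) (bmem (f i) y)).

Fixpoint check (v : vset) : bname B :=
  let: VSet A f := v in BName (fun i => check (f i)) (fun=> \top).

(* Statements about all generic extensions are statements of Boolean value 1
   in V^B: here, for every name x, "if x is a subset of some l < kappa, then
   x is in V". *)
Definition no_new_bounded_subsets d' (K : orderType d')
    (wfK : well_founded (fun x y : K => x < y)) : Prop :=
  forall x : bname B,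
    bsup (fun l : K => bsub x (check (ordinal_vset wfK l)))
      <= bsup (fun v : vset => beq x (check v)).

End BooleanAlgebra.

Arguments complete_algebra {d} B.
Arguments conditions {d} B.
Arguments no_new_bounded_subsets {d} B {d' K} wfK.

(* Main.v *)
Require Import Defs.
From mathcomp Require Import all_boot all_order.
From mathcomp Require Import boolp classical_sets functions cardinality.

Set Implicit Arguments.
Unset Strict Implicit.
Unset Printing Implicit Defensive.

(** Let D_a = { f a x | x < kappa } be predense sets, so that in a generic
extension F(a) = the least x with f a x in G is a total function from kappa to
kappa.  The task is to find a filter g in V that puts some f a x into g for
every a.  The hypothesis on bounded subsets is used in the form of
[decide_square]: for m < kappa, densely many conditions decide m x m Boolean
values.  It is obtained by applying the Boolean-valued hypothesis to the name
with Boolean values a_y, y < l; Hessenberg's theorem (an infinite well-order is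
equinumerous with its square) passes from l to m x m.

If no condition forces a cofinal function from some m < kappa to kappa, then F
is bounded on every m < kappa, hence the conditions that force values for all
F(a), a < m, are dense, and a filter that meets unboundedly many of these sets
is as desired ([exists_filter_regular]).

Otherwise kappa may become singular, and F restricted to m < kappa need not be
bounded.  Let m be the least ordinal that some condition q forces to be the
domain of a cofinal function H to kappa.  For a < kappa, some i < m satisfies
F(a) <= H(i).  For each delta < kappa a dense set of conditions below q
([catches], [dense_catches]) forces H(i) >= delta for some i < m, forces
values of H up to and including i, assigns to every
a < delta an index j < m with F(a) <= H(j), and decides all f a y with
a, y < delta.  Let g meet unboundedly many of these sets.  If g left H(j)
undecided for some j < m, then the indices i that occur would all lie below j,
and the values of H decided by g would give, in V, a cofinal function from j to
kappa, against the minimality of m.  So g decides all of H.  Then each F(a) is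
bounded by some H(j) that g knows, and g decides all f a y for y up to this
bound, so one of them belongs to g ([exists_filter_singular]). *)

Import Order.Theory.
Local Open Scope classical_set_scope.
Local Open Scope card_scope.
Local Open Scope order_scope.

(** * Hessenberg's theorem for segments of a well-order *)

Lemma card_le_funP T U (A : set T) (B : set U) : U ->
  A #<= B <->
  exists f : T -> U, (forall x, A x -> B (f x)) /\
    (forall x y, A x -> A y -> f x = f y -> x = y).
Proof.
move=> u0; elim/Ppointed: U => U in B u0 *; first by case: (no u0).
split=> [/pcard_leP/injfunPex[f fAB fI]|[f [fAB fI]]].
  by exists f; split=> // x y Ax Ay; apply: fI; rewrite inE.
apply/pcard_leP/injfunPex; exists f => // x y; rewrite !inE; exact: fI.
Qed.

Lemma card_le_setX T U (A : set T) (B : set U) :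
  A #<= B -> A `*` A #<= B `*` B.
Proof.
have [->|/set0P[a Aa] AB] := eqVneq A set0; first by rewrite set0X.
have u0 : U := val (unsquash (elimT card_leP AB) (SigSub (mem_set Aa))).
move: AB => /(card_le_funP _ _ u0)[f [fAB fI]].
apply/(card_le_funP _ _ (u0, u0)); exists (fun z => (f z.1, f z.2)).
split=> [[x y] /= [Ax Ay]|[x y] [x' y'] /= [Ax Ay] [Ax' Ay'] [/fI-> // /fI-> //]].
by split; apply: fAB.
Qed.

(** Shift a copy of the natural numbers inside [A] by one to make room for [x],
    as in Hilbert's hotel. *)
Lemma infinite_setU1_card_le T (A : set T) (x : T) :
  infinite_set A -> A `|` [set x] #<= A.
Proof.
move=> /infiniteP/(card_le_funP _ _ x)[s [sA sI]].
have {}sI m n : s m = s n -> m = n by apply: sI.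
pose h y := if pselect (A y) then
    (if pselect (exists n, y = s n) is left e then s (sval (cid e)).+1 else y)
  else s 0.
apply/(card_le_funP _ _ x); exists h; split=> [y _|y z].
  rewrite /h; case: pselect => // Ay; case: pselect => // e; exact: sA.
have hx y' : (A `|` [set x]) y' -> ~ A y' -> y' = x by case.
move=> Uy Uz; rewrite /h.
case: (pselect (A y)) => Ay; case: (pselect (A z)) => Az /=; last by move=> _; rewrite (hx _ Uy Ay) (hx _ Uz Az).
- case: (pselect (exists n, y = s n)) => ey; case: (pselect (exists n, z = s n)) => ez //.
  + by case: (cid ey) (cid ez) => m em [n en] /= /sI[mn]; rewrite em en mn.
  + by move=> e; case: ez; eexists; rewrite -e.
  + by move=> e; case: ey; eexists; rewrite e.
- by case: pselect => [ey /sI//|ey e]; case: ey; exists 0.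
- by case: pselect => [ez /sI//|ez e]; case: ez; exists 0.
Qed.

(** Map each [z], by recursion along [R], to an element of [A] not yet used on
    the predecessors of [z].  If all were used, choosing preimages would inject
    [A] into these predecessors. *)
Lemma card_le_of_small_segments T (R : T -> T -> Prop) U (Z : set T) (A : set U) :
  well_founded R ->
  (forall z w, Z z -> Z w -> z <> w -> R z w \/ R w z) ->
  (forall z, Z z -> ~ (A #<= [set w | Z w /\ R w z])) ->
  Z #<= A.
Proof.
move=> wfR totR small.
elim/Pchoice: U => U in A small *.
have [A0|/set0P[u0 Au0]] := eqVneq A set0.
  have -> : Z = set0; last exact: card_ge0.
  by rewrite -subset0 => z /small; apply; rewrite A0 card_ge0.
pose step z (F : forall w, R w z -> U) :=
  xget u0 [set u | A u /\ forall w (r : R w z), Z w -> F w r <> u].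
pose F := Fix wfR (fun=> U) step.
have FE z : F z = xget u0 [set u | A u /\ forall w, R w z -> Z w -> F w <> u].
  rewrite /F Fix_eq // => {}z f g fg; rewrite /step; congr xget.
  apply/seteqP; split=> u [Au h]; split=> // w r; first by rewrite -fg; apply: h.
  by rewrite fg; apply: h.
have FP z : Z z -> A (F z) /\ forall w, R w z -> Z w -> F w <> F z.
  move=> Zz; rewrite FE; apply: (@xgetPex _ u0 [set u | A u /\ forall w, R w z -> Z w -> F w <> u]).
  apply: contrapT => /forallNP nex; apply: (small z Zz).
  have wit u : A u -> exists w, [/\ R w z, Z w & F w = u].
    move=> Au; apply: contrapT => nw; apply: (nex u); split=> // w r Zw Fw.
    by apply: nw; exists w.
  pose k u := if pselect (A u) is left Au then sval (cid (wit u Au)) else z.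
  have kP u : A u -> [/\ R (k u) z, Z (k u) & F (k u) = u].
    by rewrite /k; case: pselect => // Au _; case: cid.
  apply/(card_le_funP _ _ z); exists k; split=> [u /kP[]|u v Au Av kuv] //.
  by case: (kP u Au) => _ _ <-; rewrite kuv; case: (kP v Av).
apply/(card_le_funP _ _ u0); exists F; split=> [z /FP[]|z w Zz Zw] // Fzw.
apply: contrapT => /(totR _ _ Zz Zw)[] r.
- by case: (FP w Zw) => _ /(_ _ r Zz).
- by case: (FP z Zz) => _ /(_ _ r Zw); apply; rewrite Fzw.
Qed.

Section Hessenberg.
Context {d : Order.disp_t} {K : orderType d}.
Hypothesis wfK : well_founded (fun x y : K => x < y).

(** Comparing maxima first confines the predecessors of a pair to the square of
    the closed segment up to its maximum. *)
Definition goedel_lt (z w : K * K) : Prop :=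
  Order.max z.1 z.2 < Order.max w.1 w.2 \/
  Order.max z.1 z.2 = Order.max w.1 w.2 /\
    (z.1 < w.1 \/ z.1 = w.1 /\ z.2 < w.2).

Lemma goedel_lt_wf : well_founded goedel_lt.
Proof.
suff H m x y : Order.max x y = m -> Acc goedel_lt (x, y) by case=> x y; exact: H.
elim/(well_founded_ind wfK): m x y => m IHm x.
elim/(well_founded_ind wfK): x => x IHx y.
elim/(well_founded_ind wfK): y => y IHy mE.
constructor=> -[x' y'] [/=|/= [e]].
  by rewrite mE => /IHm; apply.
case=> [lx|[xE ly]]; first by apply: IHx => //; rewrite e.
by subst x'; apply: IHy => //; rewrite e.
Qed.

Lemma goedel_lt_total z w : z <> w -> goedel_lt z w \/ goedel_lt w z.
Proof.
case: z w => [x y] [x' y'] ne; rewrite /goedel_lt /=.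
case: (ltgtP (Order.max x y) (Order.max x' y')) => [||e];
  [by left; left|by right; left|].
case: (ltgtP x x') => [||ex];
  [by left; right; split=> //; left|by right; right; split=> //; left|].
case: (ltgtP y y') => [||ey]; last by case: ne; rewrite ex ey.
- by left; right; split=> //; right.
- by right; right; split=> //; right.
Qed.

Lemma segment_le_setU1 (c : K) :
  [set x : K | x <= c] = [set x | x < c] `|` [set c].
Proof.
apply/seteqP; split=> x /=; first by rewrite le_eqVlt => /orP[/eqP->|]; [right|left].
by case=> [/ltW|->].
Qed.

(** By induction one may assume that the segment embeds in no smaller one.  Then
    it does not embed in the set of predecessors of a pair in Goedel's order,
    as these lie in the square of a smaller closed segment: that square is
    finite or, by induction, no larger than a smaller segment. *)
Lemma infinite_segment_square (a : K) :
  infinite_set [set x : K | x < a] ->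
  [set x : K | x < a] `*` [set x | x < a] #<= [set x | x < a].
Proof.
elim/(well_founded_ind wfK): a => a IH inf_a.
have [[b [ba ab]]|initial] :=
    pselect (exists b, b < a /\ [set x : K | x < a] #<= [set x | x < b]).
  apply: (card_le_trans (card_le_setX ab)).
  apply: (card_le_trans (B := [set x | x < b])); last first.
    by apply: subset_card_le => x /= /lt_trans; apply.
  by apply: IH => // /(card_le_finite ab).
apply: (card_le_of_small_segments goedel_lt_wf).
  by move=> z w _ _; apply: goedel_lt_total.
move=> [x y] /= [xa ya] le_seg; pose c := Order.max x y.
have ca : c < a by rewrite gt_max xa.
have {le_seg}le_sq : [set x | x < a] #<= [set x | x <= c] `*` [set x | x <= c].
  apply: (card_le_trans le_seg); apply: subset_card_le => -[u v] /= [_ g].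
  have : Order.max u v <= c by case: g => /= [/ltW|[->]].
  by rewrite ge_max => /andP.
have [fin_c|inf_c] := pselect (finite_set [set x : K | x < c]).
  apply: inf_a; apply: (card_le_finite le_sq); apply: finite_setX;
  by rewrite segment_le_setU1 finite_setU.
apply: initial; exists c; split=> //; apply: (card_le_trans le_sq).
apply: card_le_trans (IH c ca inf_c); apply: card_le_setX.
rewrite segment_le_setU1; exact: infinite_setU1_card_le.
Qed.

End Hessenberg.

(** * Consequences for an uncountable cardinal *)

Section UncountableCardinal.
Context {d : Order.disp_t} {K : orderType d}.
Hypothesis hK : uncountable_cardinal K.

(** Removing a largest element from an infinite set would not change its
    cardinality, while K is not equinumerous with a proper segment. *)
Lemma uncountable_cardinal_above (a : K) : exists b, a < b.
Proof.
apply: contrapT => na; have aT (x : K) : x <= a.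
  by rewrite leNgt; apply/negP => ax; apply: na; exists x.
have E : [set: K] = [set x | x < a] `|` [set a].
  by rewrite -segment_le_setU1; apply/seteqP; split=> x //=.
have [fin_a|inf_a] := pselect (finite_set [set x : K | x < a]).
  case: hK => _ _; apply; apply: finite_set_countable.
  by rewrite E finite_setU.
case: hK => _ /(_ a) + _; apply; rewrite E; exact: infinite_setU1_card_le.
Qed.

(** Otherwise an injected copy of the natural numbers would be unbounded and K
    a countable union of finite segments. *)
Lemma uncountable_cardinal_infinite_segment :
  exists a : K, infinite_set [set x : K | x < a].
Proof.
case: (hK) => _ _ unc; apply: contrapT => /forallNP fin.
have {}fin (a : K) : finite_set [set x : K | x < a] by apply: contrapT (fin a).
have inhK : K -> False.
  move=> k0; have : infinite_set [set: K].
    by move=> /finite_set_countable.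
  move=> /infiniteP/(card_le_funP _ _ k0)[s [_ sI]].
  have [bd|cof] := pselect (exists a, forall n, s n < a).
    case: bd => a sa; apply: (_ : infinite_set [set x : K | x < a]) (fin a).
    apply/infiniteP/(card_le_funP _ _ k0); exists s.
    by split=> [n _|n m _ _]; [exact: sa|exact: sI].
  apply: unc; suff -> : [set: K] = \bigcup_n [set x : K | x <= s n].
    apply: bigcup_countable => // n _; apply: finite_set_countable.
    by rewrite segment_le_setU1 finite_setU.
  apply/seteqP; split=> // x _; apply: contrapT => nx.
  apply: cof; exists x => n; rewrite ltNge; apply/negP => xn.
  by apply: nx; exists n.
by apply: unc; apply: finite_set_countable; suff -> : [set: K] = set0
  by []; rewrite -subset0 => k; case: (inhK k).
Qed.

Lemma segment_square_small (m : K) : exists l : K,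
  [set x : K | x < m] `*` [set x | x < m] #<= [set x : K | x < l].
Proof.
have [a inf_a] := uncountable_cardinal_infinite_segment.
pose l := Order.max m a; exists l.
have sub_l (b : K) : b <= l -> [set x : K | x < b] `<=` [set x | x < l].
  by move=> bl x /= /lt_le_trans; apply.
apply: (@card_le_trans _ _ _ ([set x : K | x < l] `*` [set x | x < l])).
  by apply/card_le_setX/subset_card_le/sub_l; rewrite le_max lexx.
apply: (infinite_segment_square (cardinal_wf hK)).
by apply: sub_infinite_set inf_a; apply: sub_l; rewrite le_max lexx orbT.
Qed.

End UncountableCardinal.

(** * Suprema and infima in a complete Boolean algebra *)

Section CompleteAlgebra.
Context {d : Order.disp_t} {B : ctbDistrLatticeType d}.
Hypothesis cB : complete_algebra B.
Implicit Types (p r c : B).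

Lemma bsup_ub (I : Type) (F : I -> B) i : F i <= bsup F.
Proof.
rewrite /bsup /supremum; case: eqP => [/seteqP[+ _]|_].
  by move=> /(_ (F i)) []; exists i.
have [s sF] := cB.2 [set b | exists i, b = F i].
by apply: (xgetI \bot sF).1; exists i.
Qed.

Lemma bsup_le (I : Type) (F : I -> B) c : (forall i, F i <= c) -> bsup F <= c.
Proof.
move=> Fc; rewrite /bsup /supremum; case: eqP => [_|_]; first exact: le0x.
have [s sF] := cB.2 [set b | exists i, b = F i].
by apply: (xgetI \bot sF).2 => _ [i ->].
Qed.

Lemma infimums_neq0 (A : set B) : infimums A !=set0.
Proof.
have [s [ub_s lub_s]] := cB.2 [set ~` a | a in A].
exists (~` s); split=> [a Aa|c cA].
  by rewrite leCx; apply: ub_s; exists a.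
by rewrite lexC; apply: lub_s => _ [a Aa <-]; rewrite leCx complK; apply: cA.
Qed.

Lemma binf_lb (I : Type) (F : I -> B) i : binf F <= F i.
Proof.
rewrite /binf /infimum; case: eqP => [/seteqP[+ _]|_].
  by move=> /(_ (F i)) []; exists i.
have [s sF] := infimums_neq0 [set b | exists i, b = F i].
by apply: (xgetI \top sF).1; exists i.
Qed.

Lemma le_binf (I : Type) (F : I -> B) c : (forall i, c <= F i) -> c <= binf F.
Proof.
move=> cF; rewrite /binf /infimum; case: eqP => [_|_]; first exact: lex1.
have [s sF] := infimums_neq0 [set b | exists i, b = F i].
by apply: (xgetI \top sF).2 => _ [i ->].
Qed.

Lemma le_bimp p a b : (p <= bimp a b) = (p `&` a <= b).
Proof. by rewrite /bimp -leBLR diffE complK. Qed.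

Lemma le_compl_neq0 p a : p != \bot -> p <= a -> p <= ~` a -> False.
Proof.
move=> p0 pa pna; move: p0; rewrite -lex0 -(meetxC a) lexI pa pna.
by [].
Qed.

Lemma meet_neq0 p a : ~ p <= ~` a -> p `&` a != \bot.
Proof. by move=> pa; apply/negP; rewrite disj_leC. Qed.

(** If [p] were disjoint from every [F i], its complement would bound the
    supremum. *)
Lemma le_bsup_compatible (I : Type) (F : I -> B) p :
  p != \bot -> p <= bsup F -> exists i, p `&` F i != \bot.
Proof.
move=> p0 pF; apply: contrapT => /forallNP nF.
apply: (le_compl_neq0 p0 pF); rewrite lexC; apply: bsup_le => i.
rewrite lexC -disj_leC; apply/negPn/negP; exact: nF.
Qed.

End CompleteAlgebra.

(** * Deciding fewer than kappa Boolean values *)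

(** Extensional equality of sets, which [beq] computes on check names. *)
Fixpoint vset_eq (v w : vset) : Prop :=
  let: VSet A f := v in let: VSet C g := w in
  (forall i, exists j, vset_eq (f i) (g j)) /\
  (forall j, exists i, vset_eq (f i) (g j)).

Lemma vset_eq_trans_sym u v w : vset_eq u w -> vset_eq v w -> vset_eq u v.
Proof.
elim: u v w => A f IH [C g] [E h] /= [fh hf] [gh hg]; split=> [i|j].
  have [k fk] := fh i; have [j gj] := hg k; exists j; exact: IH fk gj.
have [k gk] := gh j; have [i fk] := hf k; exists i; exact: IH fk gk.
Qed.

Section Ordinals.
Context {d : Order.disp_t} {K : orderType d}.
Variable wfK : well_founded (fun x y : K => x < y).

Lemma ordinal_vsetE (x : K) :
  ordinal_vset wfK x =
  VSet (fun y : {y : K | y < x} => ordinal_vset wfK (sval y)).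
Proof.
rewrite /ordinal_vset Fix_eq // => {}x f g fg; congr VSet.
by apply: funext => y.
Qed.

Lemma ordinal_vset_inj (x y : K) :
  vset_eq (ordinal_vset wfK x) (ordinal_vset wfK y) -> x = y.
Proof.
elim/(well_founded_ind wfK): x y => x IH y.
rewrite (ordinal_vsetE x) (ordinal_vsetE y) => -[/= xy yx].
case: (ltgtP x y) => // [lt_xy|lt_yx].
- have [[z lt_zx] /= e] := yx (exist _ x lt_xy).
  by have := lt_zx; rewrite (IH z lt_zx _ e) ltxx.
- have [[z lt_zy] /= e] := xy (exist _ y lt_yx).
  by have := lt_zy; rewrite -(IH y lt_yx _ e) ltxx.
Qed.

End Ordinals.

Section Distributivity.
Context {d : Order.disp_t} {B : ctbDistrLatticeType d}.
Hypothesis cB : complete_algebra B.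

(** Equality of check names has a two-valued truth value, since ground-model
    sets are already equal or different in V. *)
Lemma beq_check (v w : vset) :
  (vset_eq v w -> beq (check v) (check w) = \top :> B) /\
  (~ vset_eq v w -> beq (check v) (check w) = \bot :> B).
Proof.
elim: v w => A f IH [C g] /=; split=> [[fg gf]|nfg].
  apply/eqP; rewrite -le1x lexI; apply/andP; split; apply: (le_binf cB) => i;
    rewrite le_bimp meetxx.
  - have [j /(IH i (g j)).1 e] := fg i.
    apply: le_trans (bsup_ub cB _ j); by rewrite e meetxx.
  - have [j /(IH j (g i)).1 e] := gf i.
    apply: le_trans (bsup_ub cB _ j); by rewrite e meetxx.
apply/eqP; rewrite -lex0.
have [nf|/forallNP ng] := pselect (exists i, forall j, ~ vset_eq (f i) (g j)).
  case: nf => i ni; apply: leIx2; apply/orP; left.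
  apply: (le_trans (binf_lb cB _ i)).
  rewrite /bimp compl1 join0x; apply: (bsup_le cB) => j.
  by rewrite (IH i (g j)).2 ?meetx0.
have {ng}fg i : exists j, vset_eq (f i) (g j).
  by apply: contrapT => /forallNP n; apply: (ng i).
have [nf|/forallNP ng] := pselect (exists j, forall i, ~ vset_eq (f i) (g j)).
  case: nf => j nj; apply: leIx2; apply/orP; right.
  apply: (le_trans (binf_lb cB _ j)).
  rewrite /bimp compl1 join0x; apply: (bsup_le cB) => i.
  by rewrite (IH i (g j)).2 ?meetx0.
case: nfg; split=> // j.
by apply: contrapT => /forallNP n; apply: (ng j).
Qed.

Definition decides (r a : B) : Prop := r <= a \/ r <= ~` a.

Lemma decides_le r r' a : r' <= r -> decides r a -> decides r' a.
Proof. by move=> r'r [] h; [left|right]; apply: le_trans h. Qed.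

Context {dK : Order.disp_t} {K : orderType dK}.
Hypothesis hK : uncountable_cardinal K.
Hypothesis nK : no_new_bounded_subsets B (cardinal_wf hK).

(** The elements [a y] are the Boolean values of a name for a subset of the
    ordinal [l].  By hypothesis this subset is densely forced to be a
    ground-model set [v]; a condition that forces this decides [a y]
    according to whether the ordinal [y] is in [v]. *)
Lemma decide_segment (l : K) (a : K -> B) p : p != \bot ->
  exists r, [/\ r != \bot, r <= p & forall y, y < l -> decides r (a y)].
Proof.
move=> p0; pose o := ordinal_vset (cardinal_wf hK).
pose x := BName (fun y : {y : K | y < l} => check (o (sval y))) (fun y => a (sval y)).
(* The name is forced to be a subset of [l] whatever the [a y] are. *)
have xl : bsub x (check (o l)) = \top.
  apply/eqP; rewrite -le1x /=; apply: (le_binf cB) => -[i il].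
  rewrite le_bimp; apply: le_trans (lex1 _) _.
  rewrite /o (ordinal_vsetE _ l) /=.
  apply: le_trans (bsup_ub cB _ (exist _ i il)) => /=.
  rewrite meet1x (beq_check _ _).1 //.
  have refl v : vset_eq v v by elim: v => A f IH; split=> j; exists j.
  exact: refl.
have px : p <= bsup (fun v => beq x (check v)).
  apply: le_trans (nK x); apply: le_trans (bsup_ub cB _ l).
  by rewrite xl lex1.
have [[A f] r0] := le_bsup_compatible cB p0 px.
set r := p `&` _ in r0; exists r; split=> //; first exact: leIl.
have /= := leIr (beq x (check (VSet f))) p; rewrite -/r lexI => /andP[rx rv] y yl.
have [[j e]|ny] := pselect (exists j, vset_eq (o y) (f j)).
  left; apply: (le_trans rv); apply: (le_trans (binf_lb cB _ j)).
  rewrite /bimp compl1 join0x; apply: (bsup_le cB) => -[i il] /=.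
  have [e'|ne] := pselect (vset_eq (o i) (f j)).
    by rewrite (ordinal_vset_inj (vset_eq_trans_sym e e')) leIl.
  by rewrite (beq_check _ _).2 // meetx0 le0x.
right; apply: (le_trans rx); apply: (le_trans (binf_lb cB _ (exist _ y yl))) => /=.
rewrite /bimp leUx lexx /=; apply: (bsup_le cB) => j.
rewrite (beq_check _ _).2 ?meetx0 ?le0x // => e; apply: ny; by exists j.
Qed.

Lemma decide_square (m : K) (b : K -> K -> B) p : p != \bot ->
  exists r, [/\ r != \bot, r <= p &
    forall x y, x < m -> y < m -> decides r (b x y)].
Proof.
move=> p0; have [l /(card_le_funP _ _ m)[f [fl fI]]] := segment_square_small hK m.
pose a z := if pselect (exists w : K * K, [/\ w.1 < m, w.2 < m & f w = z])
  is left e then b (sval (cid e)).1 (sval (cid e)).2 else \bot.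
have [r [r0 rp ra]] := decide_segment l a p0.
exists r; split=> // x y xm ym; have := ra (f (x, y)) (fl (x, y) (conj xm ym)).
rewrite /a; case: pselect => [e|]; last by case; exists (x, y).
case: (cid e) => -[x' y'] /= [x'm y'm e'].
by have [-> ->] := fI (x', y') (x, y) (conj x'm y'm) (conj xm ym) e'.
Qed.

End Distributivity.

(** * Names for functions on kappa *)

Section Names.
Context {d : Order.disp_t} {B : ctbDistrLatticeType d}.
Context {dK : Order.disp_t} {K : orderType dK}.
Implicit Types (p q r : B) (h f : K -> K -> B) (i j x m delta : K).

(** A matrix [f] stands for the name of the function that maps [i] to the least
    [x] with [f i x] in the generic filter; below [q] it is total. *)
Definition defined_below q f : Prop :=
  forall i p, p != \bot -> p <= q -> exists x, p `&` f i x != \bot.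

Definition bounded_on p f m delta : Prop :=
  forall i, i < m -> exists2 x, x < delta & p <= f i x.

Definition unbounded_below q m f : Prop :=
  forall p delta, p != \bot -> p <= q -> ~ bounded_on p f m delta.

(** Some condition forces a cofinal function from [m] to kappa. *)
Definition may_singularize m : Prop :=
  exists q f, [/\ q != \bot, defined_below q f & unbounded_below q m f].

Hypothesis cB : complete_algebra B.
Hypothesis hK : uncountable_cardinal K.
Hypothesis nK : no_new_bounded_subsets B (cardinal_wf hK).

Lemma filter_consistent Q (g : set B) p r a : (Q `<=` conditions B)%classic ->
  filter_on Q g -> g p -> g r -> p <= a -> r <= ~` a -> False.
Proof.
move=> QB [gQ _ _ gdir] gp gr pa ra; have [s [gs sp sr]] := gdir p r gp gr.
apply: (le_compl_neq0 (QB _ (gQ _ gs)) (le_trans sp pa) (le_trans sr ra)).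
Qed.

(** When no [m] can become cofinal in kappa, conditions that force values of
    [f] on all of [m] are dense, because densely many conditions bound [f]
    on [m]. *)
Lemma exists_filter_regular f :
  (forall m, ~ may_singularize m) -> defined_below (\top : B) f ->
  ub_FA (conditions_below (\top : B)) K ->
  exists2 g, filter_on (conditions_below (\top : B)) g &
    forall i, exists2 p, g p & exists x, p <= f i x.
Proof.
move=> reg deff ub.
pose D m := [set p : B | p != \bot /\ exists delta, bounded_on p f m delta].
have [|g gF gD] := ub D.
  move=> m; split=> [p [p0 _]|p [p0 _]]; first by split=> //; exact: lex1.
  apply: contrapT => nD; apply: (reg m); exists p, f; split=> //.
    by move=> i r r0 _; apply: deff => //; exact: lex1.
  move=> r delta r0 rp bd; apply: nD; exists r => //; split=> //.
  by exists delta.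
exists g => // i; have [j ij] := uncountable_cardinal_above hK i.
have [m jm [p [gp [_ [delta bd]]]]] := gD j.
by have [x _ px] := bd i (lt_le_trans ij jm); exists p => //; exists x.
Qed.

(** The Boolean value of F(i) <= H(j), for the functions F and H named by [f]
    and [h], as the meet over [x] of: if [h j x] is in the generic filter, so
    is some [f i y] with [y <= x]. *)
Definition bounded_by f h i j : B :=
  binf (fun x => bimp (h j x) (bsup (fun y : {y : K | y <= x} => f i (sval y)))).

(** Force a value [y] of F(i), then decide which values below [y] H takes on [m].
    As H is unbounded, it avoids all values below [y] at some [j]. *)
Lemma exists_bounded_by q m h f i p :
  defined_below q f -> unbounded_below q m h -> p != \bot -> p <= q ->
  exists j r, [/\ j < m, r != \bot, r <= p & r <= bounded_by f h i j].
Proof.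
move=> deff unb p0 pq; have [y py0] := deff i p p0 pq.
have [r [r0 rpy dec]] := decide_square cB nK (Order.max m y) h py0.
move: rpy; rewrite lexI => /andP[rp rf].
have /existsNP[j /not_implyP[jm nj]] := unb r y r0 (le_trans rp pq).
exists j, r; split=> //; apply: (le_binf cB) => x; rewrite le_bimp.
case: (ltP x y) => [xy|yx].
  have jM : j < Order.max m y by rewrite lt_max jm.
  have xM : x < Order.max m y by rewrite lt_max xy orbT.
  have [rh|rh] := dec j x jM xM; first by case: nj; exists x.
  have : r `&` h j x == \bot by rewrite disj_leC.
  by move=> /eqP->; exact: le0x.
apply: le_trans (bsup_ub cB _ (exist _ y yx)) => /=.
by apply: leIx2; rewrite rf.
Qed.

Lemma bounded_by_le f h i j x p :
  p <= bounded_by f h i j -> p <= h j x ->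
  p <= bsup (fun y : {y : K | y <= x} => f i (sval y)).
Proof.
move=> pb ph; have := le_trans pb (binf_lb cB _ x); rewrite le_bimp.
by rewrite (meet_l ph).
Qed.

(** The index [i] is a place where H reaches [delta] and up to which H is
    already known.  Thus filters that meet these sets for unboundedly many
    [delta] know unboundedly many values of H, although no bound on their
    positions in [m] is given in advance. *)
Definition catches m h f delta r : Prop :=
  exists i, [/\ i < m,
    forall j, j <= i -> exists x, r <= h j x,
    forall x, x < delta -> r <= ~` h i x,
    forall a, a < delta -> exists2 j, j < m & r <= bounded_by f h a j &
    forall a y, a < delta -> y < delta -> decides r (f a y)].

(** Taking for [i] the first place where H reaches [delta] ensures that the
    earlier values of H are less than [delta], hence decided. *)
Lemma dense_catches q m h f delta p :
  defined_below q h -> defined_below q f -> unbounded_below q m h ->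
  p != \bot -> p <= q ->
  exists r, [/\ r != \bot, r <= p & catches m h f delta r].
Proof.
move=> defh deff unb p0 pq; pose M := Order.max m delta.
have [r1 [r10 r1p dec_h]] := decide_square cB nK M h p0.
have [r2 [r20 r21 dec_f]] := decide_square cB nK M f r10.
have [r3 [r30 r32 dec_t]] := decide_square cB nK M (bounded_by f h) r20.
have r31 := le_trans r32 r21; have r3q := le_trans r31 (le_trans r1p pq).
have mM x : x < m -> x < M by rewrite lt_max => ->.
have dM x : x < delta -> x < M by rewrite lt_max => ->; rewrite orbT.
pose late i := i < m /\ forall x, x < delta -> r3 <= ~` h i x.
have [i [[im late_i] min_i]] : exists i, late i /\ forall j, j < i -> ~ late j.
  have [i0 l0] : exists i, late i.
    have /existsNP[i /not_implyP[im ni]] := unb r3 delta r30 r3q.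
    exists i; split=> // x xd.
    have [r1h|r1h] := dec_h i x (mM i im) (dM x xd); last exact: le_trans r1h.
    by case: ni; exists x => //; exact: le_trans r1h.
  elim/(well_founded_ind (cardinal_wf hK)): i0 l0 => i0 IH l0.
  have [[j [ji lj]]|nj] := pselect (exists j, j < i0 /\ late j).
    exact: IH ji lj.
  by exists i0; split=> // j ji lj; apply: nj; exists j.
have [x0 rx0] := defh i r3 r30 r3q; pose r := r3 `&` h i x0.
have rr3 : r <= r3 by exact: leIl.
exists r; split=> //; first by rewrite (le_trans rr3) // (le_trans r31).
exists i; split=> //.
- move=> j; rewrite le_eqVlt => /orP[/eqP->|ji]; first by exists x0; exact: leIr.
  apply: contrapT => nx; apply: (min_i j ji); split; first exact: lt_trans ji im.
  move=> x xd; have [r1h|r1h] := dec_h j x (mM j (lt_trans ji im)) (dM x xd).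
    by case: nx; exists x; apply: le_trans rr3 (le_trans r31 r1h).
  exact: le_trans r31 r1h.
- by move=> x xd; apply: le_trans rr3 (late_i x xd).
- move=> a ad; have rq : r <= q by exact: le_trans r3q.
  have [j [s [jm s0 sr st]]] := exists_bounded_by a deff unb rx0 rq.
  exists j => //; apply: (le_trans rr3).
  have [//|r3t] := dec_t a j (dM a ad) (mM j jm).
  by case: (le_compl_neq0 s0 st (le_trans sr (le_trans rr3 r3t))).
- move=> a y ad yd; apply: (decides_le rr3 (decides_le r32 _)).
  exact: dec_f (dM a ad) (dM y yd).
Qed.

(** A cofinal function of the ground model remains cofinal in every extension;
    its matrix has the entries [\top] and [\bot]. *)
Lemma may_singularize_cofinal m (c : K -> K) :
  (forall delta, exists2 i, i < m & delta <= c i) -> may_singularize m.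
Proof.
move=> cof; exists \top, (fun i x => if x == c i then \top else \bot).
split=> [|i p p0 _|p delta p0 _ bd]; first by rewrite eq_sym cB.1.
  by exists (c i); rewrite eqxx meetx1.
have [i im dci] := cof delta; have [x xd] := bd i im.
case: eqP => [xc|_]; first by move: xd; rewrite xc ltNge dci.
by rewrite lex0 (negPf p0).
Qed.

(** Minimality of [m] is what makes the filter decide all of H: a filter that
    misses H(j) would define in V a cofinal function on [j], by the values of
    H that it does decide. *)
Lemma exists_filter_singular q m h f :
  defined_below q h -> defined_below q f -> unbounded_below q m h ->
  (forall j, j < m -> ~ may_singularize j) ->
  ub_FA (conditions_below q) K ->
  exists2 g, filter_on (conditions_below q) g &
    forall i, exists2 p, g p & exists x, p <= f i x.
Proof.
move=> defh deff unb min_m ub.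
pose D delta := [set r : B | conditions_below q r /\ catches m h f delta r].
have [|g gF gD] := ub D.
  move=> delta; split=> [r []|p [p0 pq]] //.
  have [r [r0 rp rc]] := dense_catches delta defh deff unb p0 pq.
  by exists r => //; split=> //; split=> //; exact: le_trans pq.
have QB : conditions_below q `<=` conditions B by move=> r [].
(* The default value of [c] is immaterial: the indices [i] used below have a
   decided value. *)
have decided_h j : j < m -> exists x, exists2 p, g p & p <= h j x.
  move=> jm; apply: contrapT => nj; apply: (min_m j jm).
  pose c i := if pselect (exists x, exists2 p, g p & p <= h i x) is left e
    then sval (cid e) else i.
  apply: (@may_singularize_cofinal _ c) => delta.
  have [delta' dd' [r [gr [_ [i [im dec late _ _]]]]]] := gD delta.
  exists i.
    rewrite ltNge; apply/negP => ji; have [x rx] := dec j ji.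
    by apply: nj; exists x, r.
  have [x rx] := dec i (lexx i).
  rewrite /c; case: pselect => [e|]; last by case; exists x, r.
  case: (cid e) => y /= [p gp py]; rewrite leNgt; apply/negP => yd.
  exact: (filter_consistent QB gF gp gr py (late y (lt_le_trans yd dd'))).
exists g => // a; have [_ _ _ gdir] := gF; have [gQ _ _ _] := gF.
(* [r1] bounds F(a) by H(j), [r2] forces H(j) <= x, and [r3] decides [f a y]
   for all [y <= x]. *)
have [d1 ad1] := uncountable_cardinal_above hK a.
have [d1' d1d1' [r1 [gr1 [_ [_ [_ _ _ cap _]]]]]] := gD d1.
have [j jm r1t] := cap a (lt_le_trans ad1 d1d1').
have [x [r2 gr2 r2h]] := decided_h j jm.
have [d2 xd2] := uncountable_cardinal_above hK (Order.max a x).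
have [d2' d2d2' [r3 [gr3 [_ [_ [_ _ _ _ dec]]]]]] := gD d2.
move: xd2; rewrite gt_max => /andP[ad2 xd2].
have [s [gs s1 s2]] := gdir r1 r2 gr1 gr2.
have [t [gt ts tr3]] := gdir s r3 gs gr3.
have tb : t <= bsup (fun y : {y : K | y <= x} => f a (sval y)).
  exact: bounded_by_le (le_trans ts (le_trans s1 r1t)) (le_trans ts (le_trans s2 r2h)).
have t0 : t != \bot by case: (gQ t gt).
have [[y yx] /= ty] := le_bsup_compatible cB t0 tb.
exists r3 => //; exists y.
have [//|r3n] := dec a y (lt_le_trans ad2 d2d2') (le_lt_trans yx (lt_le_trans xd2 d2d2')).
by move: ty; rewrite disj_leC (le_trans tr3 r3n).
Qed.

(** * Assembling the filter *)

Lemma exists_filter_deciding f :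
  (forall q : B, conditions B q -> ub_FA (conditions_below q) K) ->
  defined_below (\top : B) f ->
  exists q, exists2 g, filter_on (conditions_below q) g &
    forall i, exists2 p, g p & exists x, p <= f i x.
Proof.
move=> ub deff.
have [[m0 sing0]|/forallNP reg] := pselect (exists m, may_singularize m); last first.
  exists \top; apply: exists_filter_regular => //; apply: ub.
  by rewrite /conditions /= eq_sym cB.1.
have [m [[q [h [q0 defh unb]]] min_m]] :
    exists m, may_singularize m /\ forall j, j < m -> ~ may_singularize j.
  elim/(well_founded_ind (cardinal_wf hK)): m0 sing0 => m0 IH sing0.
  have [[j [jm sj]]|nj] := pselect (exists j, j < m0 /\ may_singularize j).
    exact: IH jm sj.
  by exists m0; split=> // j jm sj; apply: nj; exists j.
exists q; apply: (exists_filter_singular defh _ unb min_m (ub q q0)).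
by move=> i p p0 _; apply: deff => //; exact: lex1.
Qed.

Lemma filter_on_upward q (g : set B) : filter_on (conditions_below q) g ->
  filter_on (conditions B) [set x | exists2 p, g p & p <= x].
Proof.
move=> [gQ [p0 gp0] _ gdir]; split.
- move=> x [p /gQ[pn0 _] px]; apply/eqP => x0.
  by move: pn0; rewrite -lex0 -x0 px.
- by exists p0, p0.
- by move=> x y [p gp px] _ xy; exists p => //; exact: le_trans xy.
- move=> x y [p gp px] [r gr ry]; have [s [gs sp sr]] := gdir p r gp gr.
  exists s; split; [by exists s|exact: le_trans px|exact: le_trans ry].
Qed.

End Names.

Lemma card_le_enumeration T K (A : set T) (t0 : T) (k0 : K) :
  A #<= [set: K] ->
  exists e : K -> T, (forall x, A x -> exists i, e i = x) /\
    forall i, A (e i) \/ e i = t0.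
Proof.
move=> /(card_le_funP _ _ k0)[f [_ fI]].
pose e i := if pselect (exists x, A x /\ f x = i) is left h
  then sval (cid h) else t0.
exists e; split=> [x Ax|i]; last first.
  by rewrite /e; case: pselect => [h|]; [left; case: (cid h) => ? []|right].
exists (f x); rewrite /e; case: pselect => [h|]; last by case; exists x.
by case: (cid h) => y /= [Ay /fI]; apply.
Qed.

Theorem proposition1p8 (dK dB : Order.disp_t)
    (K : orderType dK) (hK : uncountable_cardinal K)
    (P : ctbDistrLatticeType dB) :
  complete_algebra P ->
  no_new_bounded_subsets P (cardinal_wf hK) ->
  (forall q : P, conditions P q -> ub_FA (conditions_below q) K) ->
  BFA (conditions P) K.
Proof.
move=> cP nK ub D preD cardD.
have [k0 _] := uncountable_cardinal_infinite_segment hK.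
(* Padding the enumeration of D a with [\bot] is harmless: no condition lies
   below [\bot]. *)
have /choice[e eP] a := card_le_enumeration \bot k0 (cardD a).
have defe : defined_below (\top : P) e.
  move=> a p p0 _; have [_ /(_ p p0)[x Dx [r [r0 rp rx]]]] := preD a.
  have [i ei] := (eP a).1 x Dx; exists i; rewrite ei.
  apply/eqP => px; move: r0; rewrite /conditions /= -lex0 -px.
  by rewrite lexI rp rx.
have [q [g gF gD]] := exists_filter_deciding cP nK ub defe.
exists [set x | exists2 p, g p & p <= x]; first exact: filter_on_upward gF.
move=> a; have [p gp [i pe]] := gD a; exists (e a i); split; first by exists p.
have [//|e0] := (eP a).2 i; have [gQ _ _ _] := gF; have [p0 _] := gQ p gp.
by move: p0; rewrite -lex0 -e0 pe.
Qed.
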